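(* Let $(\mathscr{D},H,\bar{\mathscr{D}}')$ be a rigged Hilbert space and suppose that $(\mathscr{D},\tau_{\mathscr{A}})$ is a barrelled space. Let $A,B:\mathscr{D}\to\bar{\mathscr{D}}'$ be continuous linear operators such that $A$ is positive. The following assertions are equivalent: (i) There is a positive operator $C:\mathscr{D}\to\bar{\mathscr{D}}'$ such that the operator matrix $\begin{bmatrix} A & B^* \\ B & C \end{bmatrix}$ is positive. (ii) For every $y\in\mathscr{D}$ there is a constant $M_y\geq0$ such that $|\langle Bx,y\rangle|^2\leq M_y\,\langle Ax,x\rangle$ for all $x\in\mathscr{D}$. If any of (i) or (ii) is satisfied, there exists a smallest positive operator $A_B:\mathscr{D}\to\bar{\mathscr{D}}'$ that makes the matrix $\begin{bmatrix} A & B^* \\ B & A_B \end{bmatrix}$ positive.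
   Context: Rigged Hilbert space: let $\mathscr{D}$ be a dense linear subspace of a complex Hilbert space $H$ and let $\mathcal{L}^{\dagger}(\mathscr{D})$ be the $^*$-algebra of all linear operators $T:\mathscr{D}\to H$ with $\mathscr{D}\subseteq\operatorname{dom}T^*$, $T(\mathscr{D})\subseteq\mathscr{D}$, $T^*(\mathscr{D})\subseteq\mathscr{D}$, with involution $T^\dagger:=T^*|_{\mathscr{D}}$. Let $\mathscr{A}$ be a $\dagger$-closed subalgebra of $\mathcal{L}^\dagger(\mathscr{D})$ containing the identity operator, and equip $\mathscr{D}$ with the locally convex topology $\tau_{\mathscr{A}}$ induced by the seminorms $|||x|||_T:=(\|x\|^2+\|Tx\|^2)^{1/2}$, $T\in\mathscr{A}$. Let $\bar{\mathscr{D}}'$ be the topological anti-dual (continuous conjugate-linear functionals) of $(\mathscr{D},\tau_{\mathscr{A}})$, endowed with the strong dual topology $\beta'=\beta(\bar{\mathscr{D}}',\mathscr{D})$. Then $(\mathscr{D},\tau_{\mathscr{A}})\hookrightarrow H\hookrightarrow(\bar{\mathscr{D}}',\beta')$ continuously, and $(\mathscr{D},H,\bar{\mathscr{D}}')$ is called a rigged Hilbert space. $\langle\cdot,\cdot\rangle:\bar{\mathscr{D}}'\times\mathscr{D}\to\mathbb{C}$ denotes the natural pairing $\langle\varphi,x\rangle=\varphi(x)$. When $(\mathscr{D},\tau_{\mathscr{A}})$ is barrelled, a linear operator $A:\mathscr{D}\to\bar{\mathscr{D}}'$ is $\tau_{\mathscr{A}}$-$\beta'$-continuous if and only if it is continuous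 for the weak topologies $\sigma(\mathscr{D},\bar{\mathscr{D}}')$ and $\sigma(\bar{\mathscr{D}}',\mathscr{D})$; such operators are simply called continuous. $A$ is positive if $\langle Ax,x\rangle\geq0$ for all $x\in\mathscr{D}$ (positive operators are automatically continuous). $A\leq A'$ means $A'-A$ is positive, and ''smallest'' refers to this order. The adjoint $B^*:\mathscr{D}\to\bar{\mathscr{D}}'$ of a continuous $B$ is determined by $\langle Bx,y\rangle=\overline{\langle B^*y,x\rangle}$, $x,y\in\mathscr{D}$. Operator matrices act from $\mathscr{D}\times\mathscr{D}$ to $\bar{\mathscr{D}}'\times\bar{\mathscr{D}}'$ with pairing $\langle(\varphi_1,\varphi_2),(x_1,x_2)\rangle=\langle\varphi_1,x_1\rangle+\langle\varphi_2,x_2\rangle$, and positivity of a matrix is with respect to this pairing. *)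

(* Defs.v *)
From HB Require Import structures.
From mathcomp Require Import all_boot all_order all_algebra.
From mathcomp Require Import sesquilinear complex ring.
From mathcomp Require Import boolp classical_sets functions interval_inference reals.
From mathcomp Require Import convex topology normedtype.

Set Implicit Arguments.
Unset Strict Implicit.
Unset Printing Implicit Defensive.

Import Order.TTheory GRing.Theory Num.Theory.
Import numFieldNormedType.Exports.

Local Open Scope classical_set_scope.
Local Open Scope ring_scope.

Section Seminorm.
Context (K : numFieldType) (V : lmodType K).

Record seminorm := Seminorm {
  seminorm_fun :> V -> K ;
  seminormZ : forall a x, seminorm_fun (a *: x) = `|a| * seminorm_fun x ;
  ler_seminormD : forall x y,
    seminorm_fun (x + y) <= seminorm_fun x + seminorm_fun y }.

Lemma seminorm0 (p : seminorm) : p 0 = 0.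
Proof. by rewrite -(scale0r 0) seminormZ normr0 mul0r. Qed.

Lemma seminormN (p : seminorm) x : p (- x) = p x.
Proof. by rewrite -scaleN1r seminormZ normrN1 mul1r. Qed.

Lemma seminorm_ge0 (p : seminorm) x : 0 <= p x.
Proof.
have := ler_seminormD p x (- x).
by rewrite subrr seminorm0 seminormN -mulr2n pmulrn_lge0.
Qed.

End Seminorm.

Definition seminorm_space (K : numFieldType) (V : lmodType K) (I : Type)
  (p : I -> seminorm V) : Type := V.

Section SeminormTopology.
Context (K : numFieldType) (V : lmodType K) (I : Type) (p : I -> seminorm V).
Local Notation W := (seminorm_space p).

HB.instance Definition _ := GRing.Lmodule.on W.

Definition seminorm_ball (x : W) (se : seq I * K) : set W :=
  [set y | all (fun i => p i (x - y) < se.2) se.1].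

(* finite intersections of open seminorm balls of positive radius *)
Definition seminorm_nbhs (x : W) : set_system W :=
  filter_from [set se : seq I * K | 0 < se.2] (seminorm_ball x).

HB.instance Definition _ := hasNbhs.Build W seminorm_nbhs.

Let ball_center x s e : 0 < e -> seminorm_ball x (s, e) x.
Proof.
move=> e0; rewrite /seminorm_ball/=; apply/allT => i.
by rewrite subrr seminorm0.
Qed.

Let ball_split x y z s e : 0 < e -> seminorm_ball x (s, e / 2) y ->
  seminorm_ball y (s, e / 2) z -> seminorm_ball x (s, e) z.
Proof.
move=> e0; rewrite /seminorm_ball/=; elim: s => //= i s IH.
move=> /andP[xy sxy] /andP[yz syz]; rewrite IH// andbT.
have -> : (x - z : V) = (x - y) + (y - z) by rewrite addrA subrK.
by apply: le_lt_trans (ler_seminormD _ _ _) _; rewrite (splitr e) ltrD.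
Qed.

Let ball_cat x s t e f : 0 < e -> 0 < f ->
  seminorm_ball x (s ++ t, e * f / (e + f)) `<=`
  seminorm_ball x (s, e) `&` seminorm_ball x (t, f).
Proof.
move=> e0 f0 y; rewrite /seminorm_ball/= all_cat => /andP[h1 h2].
have ef0 : 0 < e + f by rewrite addr_gt0.
split; [apply: sub_all h1 => i /= /lt_trans; apply|
        apply: sub_all h2 => i /= /lt_trans; apply].
  by rewrite ltr_pdivrMr// ltr_pM2l// ltrDr.
by rewrite ltr_pdivrMr// mulrC ltr_pM2l// ltrDl.
Qed.

Let nbhs_pfilter (x : W) : ProperFilter (nbhs x).
Proof.
apply: filter_from_proper; last first.
  by move=> [s e] /= e0; exists x; exact: ball_center.
apply: filter_from_filter; first by exists ([::], 1) => /=.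
move=> [s e] [t f] /= e0 f0; exists (s ++ t, e * f / (e + f)).
  by rewrite /= divr_gt0 ?mulr_gt0 ?addr_gt0.
exact: ball_cat.
Qed.

Let nbhs_sing (x : W) (A : set W) : nbhs x A -> A x.
Proof. by move=> [[s e] /= e0]; apply; exact: ball_center. Qed.

Let nbhs_nbhs (x : W) (A : set W) : nbhs x A -> nbhs x (nbhs^~ A).
Proof.
move=> [[s e] /= e0 sA]; exists (s, e / 2); first by rewrite /= divr_gt0.
move=> y xy; exists (s, e / 2); first by rewrite /= divr_gt0.
by move=> z yz; apply: sA; exact: ball_split yz.
Qed.

HB.instance Definition _ :=
  Nbhs_isNbhsTopological.Build W nbhs_pfilter nbhs_sing nbhs_nbhs.

Let add_cont : continuous (fun x : W * W => x.1 + x.2).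
Proof.
move=> [x y] A [[s e] /= e0 sA].
have e20 : 0 < e / 2 by rewrite divr_gt0.
exists (seminorm_ball x (s, e / 2), seminorm_ball y (s, e / 2)) => /=.
  by split; exists (s, e / 2).
move=> [x' y'] /= [xx' yy']; apply: sA.
apply: (@ball_split _ (x' + y)) => //.
- by move: xx'; rewrite /seminorm_ball/= addrC opprD addrACA subrr addr0 addrC.
- by move: yy'; rewrite /seminorm_ball/= opprD addrACA subrr add0r.
Qed.

Let scale_ball (k l : K) (x y : W) s e : 0 < e ->
  (all (fun i => `|k - l| * p i x < e / 2) s) ->
  (all (fun i => `|l| * p i (x - y) < e / 2) s) ->
  seminorm_ball (k *: x) (s, e) (l *: y).
Proof.
move=> e0 h1 h2; apply: (@ball_split _ (l *: x)) => //; rewrite /seminorm_ball/=.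
  by apply: sub_all h1 => i; rewrite -scalerBl seminormZ.
by apply: sub_all h2 => i; rewrite -scalerBr seminormZ.
Qed.

Let scale_cont : continuous (fun z : K^o * W => z.1 *: z.2).
Proof.
move=> [k x] A [[s e] /= e0 sA].
pose m := 1 + \sum_(i <- s) p i x.
have m0 : 0 < m by rewrite ltr_pwDl// sumr_ge0// => i _; exact: seminorm_ge0.
have pm : all (fun i => p i x < m) s.
  rewrite /m; elim: s {sA m m0} => //= i s IH; rewrite big_cons.
  have s0 : 0 <= \sum_(i <- s) p i x.
    by rewrite sumr_ge0// => j _; exact: seminorm_ge0.
  rewrite -[X in X < _]add0r; apply/andP; split.
    by rewrite addrCA addrC ltr_leD// ltr_pwDl.
  apply: sub_all IH => j /lt_le_trans; apply.
  by rewrite lerD2l lerDr seminorm_ge0.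
pose d := e / 2 / m; have d0 : 0 < d by rewrite !divr_gt0.
pose c := `|k| + d; have c0 : 0 < c by rewrite ltr_wpDl.
exists ([set l : K^o | `|k - l| < d], seminorm_ball x (s, e / 2 / c)) => /=.
  split; last by exists (s, e / 2 / c) => //=; rewrite !divr_gt0.
  by exists d => // l.
move=> [l y] /= [kl xy]; apply: sA; apply: scale_ball => //=.
  apply: sub_all pm => i pi; have [->|kl0] := eqVneq `|k - l| 0.
    by rewrite mul0r divr_gt0.
  have -> : e / 2 = d * m by rewrite divfK// gt_eqF.
  by rewrite ltr_pM// seminorm_ge0.
apply: sub_all xy => i; rewrite ltr_pdivlMr// => h.
rewrite mulrC; apply: le_lt_trans h; rewrite ler_wpM2l ?seminorm_ge0//.
rewrite -[l](subrK k) (le_trans (ler_normD _ _))// addrC lerD2l distrC.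
exact: ltW.
Qed.

Let ball_convex (x : W) s e : convex_set (seminorm_ball x (s, e)).
Proof.
apply/convex_setW => y z + + t t0 t1.
have s0 : 0 <= 1 - t%:num by rewrite subr_ge0 ltW.
rewrite !inE /seminorm_ball/=; elim: s => //= i s IH.
move=> /andP[xy sxy] /andP[xz sxz]; rewrite IH// andbT.
have -> : (x - (t%:num *: y + (1 - t%:num) *: z) : V) =
    t%:num *: (x - y) + (1 - t%:num) *: (x - z).
  by rewrite !scalerBr addrACA -scalerDl subrKC scale1r opprD.
apply: le_lt_trans (ler_seminormD _ _ _) _.
rewrite !seminormZ !ger0_norm// -[ltRHS](subrK (t%:num * e)) addrC.
rewrite [X in _ < X + _](_ : _ = (1 - t%:num) * e); last by rewrite mulrBl mul1r.
by apply: ler_ltD; rewrite ?ler_wpM2l ?ltr_pM2l// ltW.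
Qed.

Let ball_open (x : W) s e : open (seminorm_ball x (s, e)).
Proof.
rewrite openE => y; rewrite /interior /seminorm_ball/=.
elim: s => [_|i s IH /= /andP[xy sxy]].
  by apply: (@filterS _ _ _ setT) => //; exact: filterT.
have : nbhs y [set z : W | p i (x - z) < e].
  exists ([:: i], e - p i (x - y)); first by rewrite /= subr_gt0.
  move=> z; rewrite /seminorm_ball/= andbT ltrBrDl => /(le_lt_trans _); apply.
  have -> : (x - z : V) = (x - y) + (y - z) by rewrite addrA subrK.
  exact: ler_seminormD.
by apply: filterS2 (IH sxy) => z /= -> ->.
Qed.

Let loc_convex : exists2 B : set_system W,
  (forall b, b \in B -> convex_set b) & basis B.
Proof.
exists [set b | exists x se, b = seminorm_ball x se].
  by move=> b /[!inE] -[x [[s e] ->]]; exact: ball_convex.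
split; first by move=> b [x [[s e] ->]]; exact: ball_open.
move=> x A [[s e] /= e0 sA]; exists (seminorm_ball x (s, e)) => //=.
by split; [exists x, (s, e)|exact: ball_center].
Qed.

(* this factory only declares the uniform structure *)
HB.instance Definition _ :=
  PreTopologicalLmod_isTvs.Build K W add_cont scale_cont loc_convex.
HB.instance Definition _ :=
  PreTopologicalNmodule_isTopologicalNmodule.Build W add_cont.
HB.instance Definition _ :=
  TopologicalNmodule_isTopologicalLmodule.Build K W scale_cont.
HB.instance Definition _ := Uniform_isTvs.Build K W loc_convex.

End SeminormTopology.

Section Barrelled.
Context (K : numFieldType) (V : tvsType K).
Implicit Type S : set V.

Definition balanced_set S := forall a x, `|a| <= 1 -> S x -> S (a *: x).

Definition absorbing_set S :=
  forall x, exists2 r : K, 0 < r & forall a, `|a| <= r -> S (a *: x).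

Definition barrel S :=
  [/\ closed S, convex_set S, balanced_set S & absorbing_set S].

Definition barrelled := forall S, barrel S -> nbhs (0 : V) S.

(* bounded in the sense of topological vector spaces *)
Definition tvs_bounded S :=
  forall U : set V, nbhs (0 : V) U ->
  exists2 r : K, 0 < r & forall a, r <= `|a| -> S `<=` *:%R a @` U.

End Barrelled.

Section AntiDual.
Context (C : numClosedFieldType) (V : tvsType C).

Definition antidual_pred : {pred V -> C} :=
  fun f => `[< linear_for (Num.conj \; *%R) f /\ continuous f >].

Record antidual := AntiDual {
  antidual_fun :> V -> C ;
  antidual_funP : antidual_fun \in antidual_pred }.

HB.instance Definition _ := [isSub for antidual_fun].
HB.instance Definition _ := [Choice of antidual by <:].

Lemma antidual_submod_closed : submod_closed antidual_pred.
Proof.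
split.
  apply/asboolP; split => [a u v|x]; last exact: cvg_cst.
  by rewrite /= mulr0 addr0.
move=> a f g /asboolP[lf cf] /asboolP[lg cg]; apply/asboolP; split.
  move=> b u v; rewrite !fctE lf lg /= /GRing.scale/=.
  by rewrite mulrDr addrACA mulrCA -mulrDr.
move=> x; apply: (@cvgD C C); last exact: cg.
by apply: (@cvgZl_tmp C C); exact: cf.
Qed.

HB.instance Definition _ :=
  GRing.isSubmodClosed.Build C (V -> C) antidual_pred antidual_submod_closed.
HB.instance Definition _ := [SubChoice_isSubLmodule of antidual by <:].

(* strong dual topology: uniform convergence on the bounded subsets of V *)
HB.instance Definition _ := Topological.copy antidual
  (initial_topology
    (antidual_fun : antidual -> {family @tvs_bounded C V, V -> C})).

Lemma antidual_linear (phi : antidual) : linear_for (Num.conj \; *%R) phi.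
Proof. by have /asboolP[] := antidual_funP phi. Qed.

Lemma antidual_continuous (phi : antidual) : continuous phi.
Proof. by have /asboolP[] := antidual_funP phi. Qed.

Lemma tvs_bounded_set1 (x : V) : tvs_bounded [set x].
Proof.
move=> U U0; have := @scale_continuous C V (0, x) U.
rewrite /= scale0r => /(_ U0)[[A B] /= [[d /= d0 dA] nB] AB].
exists (2 / d); first by rewrite divr_gt0.
move=> a da _ ->; have a0 : 0 < `|a| by apply: lt_le_trans da; rewrite divr_gt0.
exists (a^-1 *: x); last by rewrite scalerA divff ?scale1r// -normr_gt0.
apply: (AB (a^-1, x)); split => /=; last exact: nbhs_singleton.
apply: dA; rewrite /= sub0r normrN normfV invf_plt//.
by apply: lt_le_trans da; rewrite ltr_pdivlMr// mulVf ?gt_eqF// ltr1n.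
Qed.

Lemma antidual_eval_continuous (x : V) :
  continuous (fun phi : antidual => phi x).
Proof.
move=> phi.
have /fam_cvgP/(_ _ (tvs_bounded_set1 x)) := @initial_continuous _ _
  (antidual_fun : antidual -> {family @tvs_bounded C V, V -> C}) phi.
rewrite (uniform_set1 _ _ (fmap_filter _ (nbhs_filter phi))).
by apply; rewrite nbhs_filterE; exact: (@fmap_filter _ _ _ _ (nbhs_filter phi)).
Qed.

Lemma conjC_continuous : continuous (Num.conj : C -> C).
Proof.
move=> z A [e /= e0 eA]; exists e => // w /= zw.
by apply: eA; rewrite /= -rmorphB norm_conjC.
Qed.

Definition pairing (phi : antidual) (x : V) : C := phi x.

Definition pairing2 (phi : antidual * antidual) (x : V * V) : C :=
  pairing phi.1 x.1 + pairing phi.2 x.2.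

(* continuity is for the strong topology on the anti-dual *)
Record continuous_operator := ContinuousOperator {
  cop_fun :> {linear V -> antidual} ;
  cop_continuous : continuous cop_fun }.

Definition op_positive (A : V -> antidual) := forall x, 0 <= pairing (A x) x.

Definition op_le (A A' : V -> antidual) := op_positive (A' \- A).

(* the operator matrix [A11, A12; A21, A22] *)
Definition op_matrix (A11 A12 A21 A22 : V -> antidual) (x : V * V) :
    antidual * antidual :=
  (A11 x.1 + A12 x.2, A21 x.1 + A22 x.2).

Definition op_matrix_positive (M : V * V -> antidual * antidual) :=
  forall x, 0 <= pairing2 (M x) x.

Section Adjoint.
Variable B : continuous_operator.

Lemma adjoint_subproof (y : V) :
  (fun x => (pairing (B x) y)^*) \in antidual_pred.
Proof.
apply/asboolP; split.
  move=> a u v; rewrite /pairing linearP /= -rmorphM -rmorphD; congr (_ ^*).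
move=> x; apply: (@continuous_comp _ _ _ (fun x => pairing (B x) y) Num.conj).
  apply: (@continuous_comp _ _ _ B (fun phi : antidual => phi y)).
    exact: cop_continuous.
  exact: antidual_eval_continuous.
exact: conjC_continuous.
Qed.

Definition adjoint_fun (y : V) : antidual := AntiDual (adjoint_subproof y).

Lemma adjoint_linear : linear adjoint_fun.
Proof.
move=> a u v; apply/val_inj/funext => x /=.
by rewrite /pairing antidual_linear/= rmorphD rmorphM/= conjCK.
Qed.

HB.instance Definition _ :=
  GRing.isLinear.Build C V antidual *:%R adjoint_fun adjoint_linear.

Definition adjoint : {linear V -> antidual} := adjoint_fun.

Lemma adjointE x y : pairing (B x) y = (pairing (adjoint y) x)^*.
Proof. by rewrite [in RHS]/pairing/= conjCK. Qed.

End Adjoint.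

End AntiDual.

Lemma minkowski2 (C : numClosedFieldType) (a b c d : C) :
  0 <= a -> 0 <= b -> 0 <= c -> 0 <= d ->
  sqrtC ((a + c) ^+ 2 + (b + d) ^+ 2) <=
  sqrtC (a ^+ 2 + b ^+ 2) + sqrtC (c ^+ 2 + d ^+ 2).
Proof.
move=> a0 b0 c0 d0.
have h (x y : C) : 0 <= x -> 0 <= y -> 0 <= x ^+ 2 + y ^+ 2.
  by move=> x0 y0; rewrite addr_ge0 ?exprn_ge0.
set u := sqrtC (a ^+ 2 + b ^+ 2); set v := sqrtC (c ^+ 2 + d ^+ 2).
have u0 : 0 <= u by rewrite sqrtC_ge0 h.
have v0 : 0 <= v by rewrite sqrtC_ge0 h.
have uE : u ^+ 2 = a ^+ 2 + b ^+ 2 by rewrite sqrtCK.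
have vE : v ^+ 2 = c ^+ 2 + d ^+ 2 by rewrite sqrtCK.
rewrite -[leRHS]sqrCK ?addr_ge0// ler_sqrtC ?qualifE/= ?exprn_ge0 ?h ?addr_ge0//.
have -> : (a + c) ^+ 2 + (b + d) ^+ 2 = u ^+ 2 + v ^+ 2 + (a * c + b * d) *+ 2.
  by rewrite uE vE; ring.
rewrite sqrrD [leRHS]addrAC lerD2l lerMn2r/=.
rewrite -(@ler_pXn2r _ 2) ?qualifE/= ?addr_ge0 ?mulr_ge0//.
rewrite exprMn uE vE -subr_ge0.
have -> : (a ^+ 2 + b ^+ 2) * (c ^+ 2 + d ^+ 2) - (a * c + b * d) ^+ 2 =
  (a * d - b * c) ^+ 2 by ring.
by rewrite real_exprn_even_ge0// rpredB ?ger0_real ?mulr_ge0.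
Qed.

Section Graph.
Context (C : numClosedFieldType) (H : normedModType C) (P : pred H).
(* D is the linear subspace {h : H | P h} of H, as a type of its own. Operators
   T : D -> H with T(D) included in D are represented by linear maps D -> D. *)
Context (D : subLmodType P).

Section Dagger.
Variable ip : {dot H for Num.conj}.

(* (y, z) is in the graph of the Hilbert space adjoint of T *)
Definition hilbert_adjoint (T : D -> D) (y z : H) :=
  forall x : D, ip (val (T x)) y = ip (val x) z.

(* D is included in the domain of the adjoint T^*, and T^* maps D into D *)
Definition Ldagger : set {linear D -> D} :=
  [set T | forall y : D, exists2 z : H, hilbert_adjoint T (val y) z & P z].

(* S is the restriction of T^* to D *)
Definition is_dagger (T S : {linear D -> D}) :=
  forall y : D, hilbert_adjoint T (val y) (val (S y)).

Record dagger_algebra (A : set {linear D -> D}) : Prop := {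
  dagger_algebra_sub : A `<=` Ldagger ;
  dagger_algebra1 : A idfun ;
  dagger_algebraP : forall (a : C) T S, A T -> A S -> A (a \*: T \+ S) ;
  dagger_algebraM : forall T S, A T -> A S -> A (T \o S) ;
  dagger_algebra_dagger : forall T S, A T -> is_dagger T S -> A S }.

End Dagger.

Section GraphSeminorm.
Variable T : {linear D -> D}.

Definition graph_norm (x : D) : C := sqrtC (`|val x| ^+ 2 + `|val (T x)| ^+ 2).

Lemma graph_normZ a x : graph_norm (a *: x) = `|a| * graph_norm x.
Proof.
rewrite /graph_norm !linearZ !normrZ !exprMn -mulrDr.
by rewrite sqrtCM ?qualifE/= ?addr_ge0 ?exprn_ge0// sqrCK.
Qed.

Lemma ler_graph_normD x y : graph_norm (x + y) <= graph_norm x + graph_norm y.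
Proof.
rewrite /graph_norm !linearD /=.
set a := val x; set b := val (T x); set c := val y; set d := val (T y).
apply: le_trans (minkowski2 _ _ _ _) => //.
rewrite ler_sqrtC ?qualifE/= ?addr_ge0 ?exprn_ge0 ?addr_ge0//.
by rewrite lerD// lerXn2r ?qualifE/= ?addr_ge0// ler_normD.
Qed.

Definition graph_seminorm := Seminorm graph_normZ ler_graph_normD.

End GraphSeminorm.

Definition graph_space (A : set {linear D -> D}) : tvsType C :=
  seminorm_space (fun T : {T | A T} => graph_seminorm (sval T)).

End Graph.

(* Main.v *)
(* The least value of [A_B] at [y] is the supremum over [x] of
   [2 Re <B x, y> - <A x, x>].  An almost maximizer [w] almost represents the
   functional [x |-> <B x, y>] by [<A x, w>], and [<B w, z>] converges as the
   error tends to [0]; its limit [t y z] is a sesquilinear form, which avoids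
   completing the space for the form of [A].  Finally
   [|<B x, y>| <= <A x, x>^(1/2) for all x] defines a barrel in [y] on which
   [t y] is bounded, so barrelledness makes [t y] continuous. *)
From HB Require Import structures.
Require Import Defs.
From mathcomp Require Import all_boot all_order all_algebra.
From mathcomp Require Import sesquilinear complex.
From mathcomp Require Import boolp classical_sets functions interval_inference reals.
From mathcomp Require Import topology normedtype.
From mathcomp Require Import ring convex.

Set Implicit Arguments.
Unset Strict Implicit.
Unset Printing Implicit Defensive.

Import Order.TTheory GRing.Theory Num.Theory.
Import numFieldNormedType.Exports.

Local Open Scope classical_set_scope.
Local Open Scope ring_scope.

(** * Inequalities that hold up to a small error, and the discriminant *)

(** The order is only partial: the case [e = 1] shows that [y - x] is real, and a single small [e]
    then excludes a negative value. *)
Lemma ler_smallP (F : numFieldType) (x y K : F) : 0 <= K ->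
  (forall e, 0 < e -> e <= 1 -> x <= y + K * e) -> x <= y.
Proof.
move=> K0 h; rewrite -subr_ge0.
have h' e : 0 < e -> e <= 1 -> 0 <= (y - x) + K * e.
  by move=> e0 e1; rewrite addrAC subr_ge0 h.
have zr : y - x \is Num.real.
  by rewrite -[y - x](addrK (K * 1)) rpredB ?ger0_real ?h' ?mulr_ge0.
rewrite real_leNgt ?real0//; apply/negP => z0.
have n0 : 0 < x - y by rewrite -opprB oppr_gt0.
have d0 : 0 < x - y + K by rewrite ltr_wpDr.
(* This [e] is at most 1 and satisfies [K * e < x - y]. *)
have := h' ((x - y) / (x - y + K)) (divr_gt0 n0 d0).
rewrite ler_pdivrMr// mul1r lerDl => /(_ K0).
rewrite -opprB addrC subr_ge0 mulrCA -ler_pdivrMl// mulVf ?gt_eqF//.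
by rewrite ler_pdivlMr// mul1r lt_geF// ltrDr.
Qed.

Lemma normr_small_eq0 (F : numFieldType) (x K : F) : 0 <= K ->
  (forall e, 0 < e -> e <= 1 -> `|x| <= K * e) -> x = 0.
Proof.
move=> K0 h; apply/eqP; rewrite -normr_le0; apply: (ler_smallP K0) => e e0 e1.
by rewrite add0r h.
Qed.

(** Being nonnegative includes being real, so it is tested as the equation between [x] and its
    modulus, whose defect is at most twice the distance from [x] to [r]. *)
Lemma ger0_approx (F : numFieldType) (x K : F) : 0 <= K ->
  (forall e, 0 < e -> e <= 1 -> exists2 r, 0 <= r & `|x - r| <= K * e) -> 0 <= x.
Proof.
move=> K0 h; rewrite ger0_def -subr_eq0; apply/eqP.
apply: (@normr_small_eq0 _ _ (K + K)); first exact: addr_ge0.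
move=> e e0 e1; have [r r0 xr] := h e e0 e1.
have -> : `|x| - x = (`|x| - `|r|) + (r - x) by rewrite (ger0_norm r0) addrA subrK.
rewrite (le_trans (ler_normD _ _))// mulrDl lerD ?(distrC r)//.
exact: le_trans (ler_dist_dist _ _) _.
Qed.

Lemma discriminant_le (F : numClosedFieldType) (A g d : F) : 0 <= A -> 0 <= d ->
  (forall k, 0 <= `|k| ^+ 2 * A + (k * g + (k * g)^*) + d) ->
  `|g| ^+ 2 <= A * d.
Proof.
move=> A0 d0 h.
have h' s : 0 <= s -> 0 <= s ^+ 2 * `|g| ^+ 2 * A - 2 * s * `|g| ^+ 2 + d.
  move=> s0; have := h (- (s * g^*)).
  rewrite normrN normrM norm_conjC (ger0_norm s0) exprMn.
  have -> : - (s * g^*) * g = - (s * `|g| ^+ 2) by rewrite normCK; ring.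
  rewrite rmorphN rmorphM rmorphXn/= conj_normC (CrealP (ger0_real s0)).
  by congr (0 <= _); ring.
have [g0|g0] := eqVneq g 0; first by rewrite g0 normr0 expr0n/= mulr_ge0.
have G0 : 0 < `|g| ^+ 2 by rewrite exprn_gt0// normr_gt0.
have [A00|An0] := eqVneq A 0.
  (* For [A = 0] the polynomial is affine with negative slope, and this [s] gives it the value
     -1. *)
  have := h' ((d + 1) / `|g| ^+ 2 / 2).
  rewrite A00 !mulr0 sub0r => /(_ (ltW _)); rewrite !divr_gt0 ?ltr_wpDl//.
  have -> : - (2 * ((d + 1) / `|g| ^+ 2 / 2) * `|g| ^+ 2) + d = -1.
    by field; rewrite normr_eq0.
  by move=> /(_ isT); rewrite oppr_ge0 ler10.
have := h' A^-1; rewrite invr_ge0 => /(_ A0).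
have -> : A^-1 ^+ 2 * `|g| ^+ 2 * A - 2 * A^-1 * `|g| ^+ 2 + d =
   d - A^-1 * `|g| ^+ 2 by field.
by rewrite subr_ge0 ler_pdivrMl// lt0r An0.
Qed.

(** * Common points of pairwise meeting balls, and almost maximizers *)

(** Helly's theorem on the line: every right endpoint bounds all left endpoints, so the supremum of
    the left endpoints lies in every interval. *)
Lemma real_balls_meet (R : realType) (I : Type) (P : set I) (c r : I -> R) :
  P !=set0 -> (forall i j, P i -> P j -> c i - c j <= r i + r j) ->
  exists t, forall i, P i -> `|c i - t| <= r i.
Proof.
move=> [i0 Pi0] h; exists (sup ((fun i => c i - r i) @` P)) => i Pi.
have ub j : P j -> ubound ((fun i => c i - r i) @` P) (c j + r j).
  by move=> Pj _ [k Pk <-]; rewrite lerBlDr -addrA -lerBlDl (addrC (r j)) h.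
have ne : (fun i => c i - r i) @` P !=set0 by exists (c i0 - r i0), i0.
have le1 := ge_sup ne (ub _ Pi).
have le2 : c i - r i <= sup ((fun i => c i - r i) @` P).
  by apply: ub_le_sup; [exists (c i0 + r i0); exact: ub|exists i].
by rewrite ler_norml lerNl opprB !lerBlDl le1 addrC -lerBlDl.
Qed.

Section Complex.
Context (R : realType).
Local Notation C := R[i].

(* The radii are doubled because the real and imaginary parts are treated
   separately. *)
Lemma complex_balls_meet (I : Type) (P : set I) (c r : I -> C) :
  P !=set0 -> (forall i j, P i -> P j -> `|c i - c j| <= r i + r j) ->
  exists t, forall i, P i -> `|c i - t| <= 2 * r i.
Proof.
move=> P0 h.
have rr i : P i -> r i = (complex.Re (r i))%:C%C.
  move=> Pi; rewrite RRe_real// ger0_real//.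
  by have := h i i Pi Pi; rewrite subrr normr0 -mulr2n pmulrn_lge0.
have re i j : P i -> P j ->
    complex.Re (c i) - complex.Re (c j) <= complex.Re (r i) + complex.Re (r j).
  move=> Pi Pj; have := h i j Pi Pj; rewrite {1}(rr i)// {1}(rr j)// -rmorphD.
  move=> /(le_trans (normc_ge_Re _)); rewrite lecR; apply: le_trans.
  by apply: le_trans (ler_norm _); rewrite raddfB.
have im i j : P i -> P j ->
    complex.Im (c i) - complex.Im (c j) <= complex.Re (r i) + complex.Re (r j).
  move=> Pi Pj; have := h i j Pi Pj; rewrite {1}(rr i)// {1}(rr j)// -rmorphD.
  (* Multiplication by the imaginary unit turns the imaginary part into a real part, up to sign,
     without changing the modulus. *)
  have -> : `|c i - c j| = `|(c j - c i) * 'i%C|.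
    by rewrite normrM complexiE normCi mulr1 distrC.
  move=> /(le_trans (normc_ge_Re _)); rewrite lecR; apply: le_trans.
  by apply: le_trans (ler_norm _); rewrite ReiNIm raddfB/= opprB.
have [t1 ht1] := real_balls_meet P0 re.
have [t2 ht2] := real_balls_meet P0 im.
exists (t1%:C%C + 'i%C * t2%:C%C) => i Pi.
have -> : c i - (t1%:C%C + 'i%C * t2%:C%C) =
    (complex.Re (c i) - t1)%:C%C + 'i%C * (complex.Im (c i) - t2)%:C%C.
  by rewrite {1}[c i]complexE !rmorphB/=; ring.
rewrite (le_trans (ler_normD _ _))// normrM complexiE normCi mul1r.
rewrite mulr_natl mulr2n (rr i)//.
have nR (x : R) : `|x%:C%C| = `|x|%:C%C.
  by rewrite normc_def/= expr0n/= addr0 sqrtr_sqr.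
by rewrite !nR lerD// lecR ?ht1 ?ht2.
Qed.

Lemma approx_maximizer (T : Type) (x0 : T) (f : T -> C) (K d : C) :
  (forall x, f x \is Num.real) -> (forall x, f x <= K) -> 0 < d ->
  exists w, forall x, f x <= f w + d.
Proof.
move=> fr fK d0; pose E := range (@complex.Re R \o f).
have hE : has_sup E.
  split; first by exists (complex.Re (f x0)); exists x0.
  exists (complex.Re K) => _ [x _ <-] /=.
  by have := fK x; rewrite lecE => /andP[].
have dR : 0 < complex.Re d by move: d0; rewrite ltcE => /andP[].
have [_ [w _ <-] /= hw] := sup_adherent dR hE; exists w => x.
rewrite -(RRe_real (fr x)) -(RRe_real (fr w)) -(RRe_real (gtr0_real d0)).
rewrite -rmorphD lecR; apply: (@le_trans _ _ (sup E)).
  by apply: (ub_le_sup hE.2); exists x.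
by rewrite -lerBlDr ltW.
Qed.

End Complex.

(** * Sesquilinear forms and approximate representatives *)

Section Sesquilinear.
Context (C : numClosedFieldType) (V : lmodType C).

Record sesquilinear_form (f : V -> V -> C) : Prop := {
  sesq_linearl : forall k x y z, f (k *: x + y) z = k * f x z + f y z ;
  sesq_linearr : forall k x y z, f z (k *: x + y) = k^* * f z x + f z y }.

Section Rules.
Context (f : V -> V -> C) (fS : sesquilinear_form f).

Lemma sesqDl x y z : f (x + y) z = f x z + f y z.
Proof. by have := sesq_linearl fS 1 x y z; rewrite scale1r mul1r. Qed.

Lemma sesqDr x y z : f z (x + y) = f z x + f z y.
Proof. by have := sesq_linearr fS 1 x y z; rewrite scale1r rmorph1 mul1r. Qed.

Lemma sesq0l z : f 0 z = 0.
Proof. by apply: (addrI (f 0 z)); rewrite -sesqDl !addr0. Qed.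

Lemma sesq0r z : f z 0 = 0.
Proof. by apply: (addrI (f z 0)); rewrite -sesqDr !addr0. Qed.

Lemma sesqZl k x z : f (k *: x) z = k * f x z.
Proof. by rewrite -[k *: x]addr0 (sesq_linearl fS) sesq0l addr0. Qed.

Lemma sesqZr k x z : f z (k *: x) = k^* * f z x.
Proof. by rewrite -[k *: x]addr0 (sesq_linearr fS) sesq0r addr0. Qed.

Lemma sesqNl x z : f (- x) z = - f x z.
Proof. by rewrite -scaleN1r sesqZl mulN1r. Qed.

Lemma sesqNr x z : f z (- x) = - f z x.
Proof. by rewrite -scaleN1r sesqZr rmorphN rmorph1 mulN1r. Qed.

End Rules.

(** Polarization: reality of the form at [x + y] and at [x + 'i *: y] gives two linear relations,
    whose sum is twice the claim. *)
Lemma sesq_hermitian (f : V -> V -> C) : sesquilinear_form f ->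
  (forall x, f x x \is Num.real) -> forall x y, (f x y)^* = f y x.
Proof.
move=> fS fr x y.
have h z w : (f z w)^* + (f w z)^* = f z w + f w z.
  have := fr (z + w); rewrite (sesqDl fS) !(sesqDr fS) => /CrealP.
  rewrite !rmorphD/= !(CrealP (fr _)).
  rewrite -[f z z + (f z w)^* + _]addrA -[f z z + f z w + _]addrA => /addrI.
  by rewrite !addrA => /addIr.
have h1 := h x y.
have := h x ('i *: y); rewrite !(sesqZl fS) !(sesqZr fS) !rmorphM/= conjCK conjCi.
move=> h2; have {}h2 : 'i * ((f x y)^* - (f y x)^* - (f y x - f x y)) = 0.
  have -> : 'i * ((f x y)^* - (f y x)^* - (f y x - f x y)) =
    ('i * (f x y)^* + - 'i * (f y x)^*) - (- 'i * f x y + 'i * f y x) by ring.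
  by rewrite h2 subrr.
move/eqP: h2; rewrite mulf_eq0 (negbTE (neq0Ci _))/= subr_eq0 => /eqP h2.
apply: (mulfI (_ : 2 != 0)); first by rewrite pnatr_eq0.
transitivity (((f x y)^* + (f y x)^*) + ((f x y)^* - (f y x)^*)); first by ring.
by rewrite h1 h2; ring.
Qed.

Section Positive.
Context (a : V -> V -> C) (aS : sesquilinear_form a) (a_ge0 : forall x, 0 <= a x x).

Definition form_norm x := sqrtC (a x x).

Lemma form_norm_ge0 x : 0 <= form_norm x.
Proof. by rewrite sqrtC_ge0. Qed.

Lemma sqr_form_norm x : form_norm x ^+ 2 = a x x.
Proof. by rewrite sqrtCK. Qed.

(** The sign of [m] is part of the definition because the inequality does not force it where
    [form_norm] vanishes identically. *)
Definition dominated (f : V -> C) (m : C) :=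
  0 <= m /\ forall x, `|f x| <= m * form_norm x.

Lemma dominated_linear k f g m n : dominated f m -> dominated g n ->
  dominated (fun x => k * f x + g x) (`|k| * m + n).
Proof.
move=> [m0 fm] [n0 gn]; split=> [|x]; first by rewrite addr_ge0 ?mulr_ge0.
rewrite (le_trans (ler_normD _ _))// mulrDl lerD// normrM -mulrA.
by rewrite ler_wpM2l.
Qed.

Lemma eq_dominated f g m : f =1 g -> dominated f m -> dominated g m.
Proof. by move=> fg [m0 fm]; split=> // x; rewrite -fg. Qed.

(** Evaluation at [u] bounds the square of [form_norm u] by [m * form_norm u], and a nonzero factor
    cancels. *)
Lemma form_norm_le u m : dominated (a^~ u) m -> form_norm u <= m.
Proof.
move=> [m0 /(_ u)]; rewrite ger0_norm// -sqr_form_norm expr2.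
have [->//|u0] := eqVneq (form_norm u) 0.
by rewrite ler_pM2r// lt0r u0 form_norm_ge0.
Qed.

(* Up to [e], the functional [b ^~ y] is represented by [w] with respect to
   [a]; no exact representative need exist, as [V] is not complete for [a]. *)
Definition represents (b : V -> V -> C) e w y :=
  dominated (fun x => b x y - a x w) e.

Context (b : V -> V -> C) (bS : sesquilinear_form b).

Lemma represents_linear k e w y e' w' y' :
  represents b e w y -> represents b e' w' y' ->
  represents b (`|k| * e + e') (k *: w + w') (k *: y + y').
Proof.
move=> h h'; rewrite -norm_conjC.
apply: eq_dominated (dominated_linear k^* h h') => x.
by rewrite (sesq_linearr aS) (sesq_linearr bS); ring.
Qed.

(** Subtracting the two errors cancels [b x y] and leaves the functional [a x (w - w')]. *)
Lemma represents_dist e w e' w' y :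
  represents b e w y -> represents b e' w' y -> form_norm (w - w') <= e + e'.
Proof.
move=> h h'; apply: form_norm_le.
rewrite -[e]mul1r -(normrN1 C).
apply: eq_dominated (dominated_linear (-1) h h') => x.
by rewrite (sesqDr aS) (sesqNr aS); ring.
Qed.

(** This is the Cauchy estimate for the values [b w z]: the balls of radius [m * e] about them
    satisfy the hypothesis of [complex_balls_meet]. *)
Lemma represents_form_dist e w e' w' y z m : dominated (b^~ z) m ->
  represents b e w y -> represents b e' w' y ->
  `|b w z - b w' z| <= m * (e + e').
Proof.
move=> [m0 bm] h h'; rewrite -(sesqNl bS) -(sesqDl bS).
by rewrite (le_trans (bm _))// ler_wpM2l//; exact: represents_dist h h'.
Qed.

End Positive.
End Sesquilinear.

(** * The limit form: existence, positivity and minimality *)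

Section Representation.
Context (R : realType) (V : lmodType R[i]).
Local Notation C := R[i].
Context (a b : V -> V -> C).
Context (aS : sesquilinear_form a) (a_ge0 : forall x, 0 <= a x x).
Context (bS : sesquilinear_form b).
Local Notation "p[ x ]" := (form_norm a x).

(* An almost maximizer [w] of [2 Re (b w y) - a w w] almost represents [y]. *)
Lemma represents_exists y m e : dominated a (b^~ y) m -> 0 < e ->
  exists w, represents a b e w y.
Proof.
move=> [m0 bm] e0; pose f w := b w y + (b w y)^* - a w w.
have aH := sesq_hermitian aS (fun x => ger0_real (a_ge0 x)).
have fr w : f w \is Num.real.
  by apply/CrealP; rewrite !rmorphD/= conjCK rmorphN/= aH [X in X - _]addrC.
have fm w : f w <= m ^+ 2.
  have n2 : b w y + (b w y)^* <= 2 * (m * p[w]).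
    have /real_ler_norm : b w y + (b w y)^* \is Num.real.
      by apply/CrealP; rewrite rmorphD/= conjCK addrC.
    move=> /le_trans; apply; rewrite (le_trans (ler_normD _ _))// norm_conjC.
    by rewrite mulr_natl mulr2n lerD.
  rewrite /f lerBlDr (le_trans n2)// -(sqr_form_norm a) -subr_ge0.
  have -> : m ^+ 2 + p[w] ^+ 2 - 2 * (m * p[w]) = (m - p[w]) ^+ 2 by ring.
  by rewrite real_exprn_even_ge0// rpredB// ger0_real// form_norm_ge0.
(* The defect is [e ^+ 2] because the discriminant bound controls the square of the error. *)
have [w hw] := approx_maximizer 0 fr fm (exprn_gt0 2 e0).
exists w; split=> [|x]; first exact: ltW.
rewrite -(@ler_pXn2r _ 2) ?qualifE/= ?mulr_ge0 ?form_norm_ge0 ?(ltW e0)//.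
rewrite exprMn sqr_form_norm mulrC; apply: discriminant_le => //.
  by rewrite exprn_ge0// ltW.
(* Comparing [w] with [w - k *: x] gives a quadratic in [k] with coefficients [a x x],
   [b x y - a x w] and [e ^+ 2]. *)
move=> k; have := hw (w - k *: x); rewrite -subr_ge0; congr (0 <= _).
rewrite /f !(sesqDl bS, sesqDl aS, sesqDr aS, sesqNl bS, sesqNl aS, sesqNr aS).
rewrite !(sesqZl bS, sesqZl aS, sesqZr aS) !(rmorphD, rmorphN, rmorphM)/= normCK.
by rewrite (aH x w); ring.
Qed.

Context (bd : forall y, exists m, dominated a (b^~ y) m).

Lemma representing_form : exists t : V -> V -> C, forall y z w e m,
  represents a b e w y -> dominated a (b^~ z) m -> `|b w z - t y z| <= m * e.
Proof.
suff h y z : exists t, forall w e m, represents a b e w y ->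
    dominated a (b^~ z) m -> `|b w z - t| <= m * e.
  have /choice[t ht] : forall yz : V * V, exists t, forall w e m,
    represents a b e w yz.1 -> dominated a (b^~ yz.2) m ->
    `|b w yz.2 - t| <= m * e by move=> [y z]; exact: h.
  by exists (fun y z => t (y, z)) => y z; exact: (ht (y, z)).
have [n yn] := bd y; have [m0 zm0] := bd z.
have [||t ht] := @complex_balls_meet R (V * C)
    [set we | represents a b we.2 we.1 y] (fun we => b we.1 z) (fun we => m0 * we.2).
- by have [w yw] := represents_exists yn ltr01; exists (w, 1).
- move=> [w e] [w' e'] /= yw yw'; rewrite -mulrDr.
  exact: (represents_form_dist aS a_ge0 bS zm0 yw yw').
(* The common point [t] comes with the constant [2 * m0]. Passing through ever finer representatives
   [w'] confines that constant to a term in [e'] and leaves [m * e]. *)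
exists t => w e m yw zm; have m0_ge0 := zm0.1; have m_ge0 := zm.1.
apply: (@ler_smallP _ _ _ (m + 2 * m0)) => [|e' e'0 _].
  by rewrite addr_ge0 ?mulr_ge0.
have [w' yw'] := represents_exists yn e'0.
have -> : b w z - t = (b w z - b w' z) + (b w' z - t) by rewrite addrA subrK.
rewrite (le_trans (ler_normD _ _))// mulrDl addrA -mulrDr -mulrA lerD//.
  exact: (represents_form_dist aS a_ge0 bS zm yw yw').
exact: (ht (w', e')).
Qed.

Context (t : V -> V -> C).
Context (tP : forall y z w e m,
  represents a b e w y -> dominated a (b^~ z) m -> `|b w z - t y z| <= m * e).

(** Both identities hold exactly for [b] and pass to [t] up to a multiple of [e]. In the first
    variable [k *: w + w'] represents [k *: y + y']; in the second, one [w] serves all terms. *)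
Lemma representing_form_sesquilinear : sesquilinear_form t.
Proof.
split=> [k y y' z|k z z' y]; apply/eqP; rewrite -subr_eq0; apply/eqP.
- have [m zm] := bd z; have [n yn] := bd y; have [n' yn'] := bd y'.
  have m0 := zm.1; apply: (@normr_small_eq0 _ _ (2 * m * (`|k| + 1))) => [|e e0 _].
    by rewrite !mulr_ge0// addr_ge0.
  have [w yw] := represents_exists yn e0; have [w' yw'] := represents_exists yn' e0.
  have yw2 := represents_linear aS bS k yw yw'.
  have -> : t (k *: y + y') z - (k * t y z + t y' z) =
      - (b (k *: w + w') z - t (k *: y + y') z) + k * (b w z - t y z) +
      (b w' z - t y' z).
    by rewrite (sesq_linearl bS); ring.
  have -> : 2 * m * (`|k| + 1) * e = m * (`|k| * e + e) + `|k| * (m * e) + m * e.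
    by ring.
  rewrite (le_trans (ler_normD _ _))// lerD ?(tP yw' zm)//.
  rewrite (le_trans (ler_normD _ _))// lerD ?normrN ?(tP yw2 zm)//.
  by rewrite normrM ler_wpM2l ?(tP yw zm).
- have [m zm] := bd z; have [m' zm'] := bd z'; have [n yn] := bd y.
  have [m2 zm2] := bd (k *: z + z').
  have m0 := zm.1; have m'0 := zm'.1; have m20 := zm2.1.
  apply: (@normr_small_eq0 _ _ (m2 + `|k| * m + m')) => [|e e0 _].
    by rewrite !addr_ge0 ?mulr_ge0.
  have [w yw] := represents_exists yn e0.
  have -> : t y (k *: z + z') - (k^* * t y z + t y z') =
      - (b w (k *: z + z') - t y (k *: z + z')) + k^* * (b w z - t y z) +
      (b w z' - t y z').
    by rewrite (sesq_linearr bS); ring.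
  rewrite !mulrDl -mulrA.
  rewrite (le_trans (ler_normD _ _))// lerD ?(tP yw zm')//.
  rewrite (le_trans (ler_normD _ _))// lerD ?normrN ?(tP yw zm2)//.
  by rewrite normrM norm_conjC ler_wpM2l ?(tP yw zm).
Qed.

(** The functional [a x w] differs from [b x y] by an error dominated by [e]. Hence representatives
    stay bounded as [e] tends to 0. *)
Lemma representing_norm_le y w e m : dominated a (b^~ y) m ->
  represents a b e w y -> p[w] <= m + e.
Proof.
move=> ym yw; apply: form_norm_le => //; rewrite addrC -[e]mul1r -(normrN1 C).
by apply: eq_dominated (dominated_linear (-1) yw ym) => x; ring.
Qed.

(* The form is within [O(e)] of [a (x + w) (x + w)] when [w] represents [y] up
   to [e]. *)
Lemma representing_form_ge0 x y : 0 <= a x x + (b x y + (b x y)^*) + t y y.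
Proof.
have aH := sesq_hermitian aS (fun x => ger0_real (a_ge0 x)).
have [m ym] := bd y; have m0 := ym.1.
(* The error at [x] enters twice, once conjugated; [m] comes from [t y y], and [m + 1] bounds the
   norm of [w] when [e <= 1]. *)
apply: (@ger0_approx _ _ (p[x] + p[x] + m + (m + 1))) => [|e e0 e1].
  by rewrite !addr_ge0// form_norm_ge0.
have [w yw] := represents_exists ym e0.
exists (a (x + w) (x + w)) => //.
have -> : a x x + (b x y + (b x y)^*) + t y y - a (x + w) (x + w) =
    (b x y - a x w) + (b x y - a x w)^* - (b w y - t y y) + (b w y - a w w).
  by rewrite !(sesqDl aS, sesqDr aS) rmorphB/= aH; ring.
have [_ h] := yw.
have h1 : `|b x y - a x w| <= p[x] * e by rewrite mulrC.
have h2 : `|b w y - a w w| <= (m + 1) * e.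
  rewrite (le_trans (h w))// mulrC ler_wpM2r ?(ltW e0)//.
  by rewrite (le_trans (representing_norm_le ym yw))// lerD2l.
rewrite [leRHS]mulrDl (le_trans (ler_normD _ _))// lerD//.
rewrite [leRHS]mulrDl (le_trans (ler_normB _ _))// lerD ?(tP yw ym)//.
by rewrite [leRHS]mulrDl (le_trans (ler_normD _ _))// lerD ?norm_conjC.
Qed.

(** Up to a multiple of [e], both [a w w] and [b w y] equal [t y y], so at [x = - w] the hypothesis
    tends to the claim. *)
Lemma representing_form_min y c :
  (forall x, 0 <= a x x + (b x y + (b x y)^*) + c) -> 0 <= c - t y y.
Proof.
move=> h; have [m ym] := bd y; have m0 := ym.1.
apply: (@ger0_approx _ _ (m + (m + 1))) => [|e e0 e1]; first by rewrite !addr_ge0.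
have [w yw] := represents_exists ym e0.
exists (a (- w) (- w) + (b (- w) y + (b (- w) y)^*) + c) => //.
have -> : c - t y y - (a (- w) (- w) + (b (- w) y + (b (- w) y)^*) + c) =
    (b w y - t y y) + (b w y - a w w)^*.
  rewrite !(sesqNl aS, sesqNr aS, sesqNl bS) rmorphB rmorphN/=.
  by rewrite (CrealP (ger0_real (a_ge0 w))); ring.
have [_ /(_ w) h'] := yw.
rewrite mulrDl (le_trans (ler_normD _ _))// lerD ?(tP yw ym)// norm_conjC mulrC.
rewrite (le_trans h')// ler_wpM2l ?(ltW e0)//.
by rewrite (le_trans (representing_norm_le ym yw))// lerD2l.
Qed.

End Representation.

(** * From forms back to operators: the barrel and continuity *)

Lemma antilinear_bounded_continuous (C : numClosedFieldType) (V : tvsType C)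
    (f : V -> C) (S : set V) (K : C) :
  linear_for (Num.conj \; *%R) f -> nbhs (0 : V) S -> 0 <= K ->
  (forall x, S x -> `|f x| <= K) -> continuous f.
Proof.
move=> fL S0 K0 fK x A [e /= e0 eA].
have K1 : 0 < K + 1 by rewrite ltr_wpDl.
have r0 : 0 < e / (K + 1) by rewrite divr_gt0.
have := nbhsT x (nbhs0Z (lt0r_neq0 r0) S0).
apply: filterS => _ [_ [s Ss <-] <-]; apply: eA => /=.
rewrite [x + _]addrC fL /= [X in _ - X]addrC opprD addrA subrr add0r normrN normrM norm_conjC.
rewrite (gtr0_norm r0) mulrAC ltr_pdivrMr// ltr_pM2l//.
by rewrite (le_lt_trans (fK _ Ss))// ltrDl.
Qed.

Section Operators.
Context (R : realType) (V : tvsType R[i]).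
Local Notation C := R[i].

Definition op_form (T : V -> antidual V) (x y : V) : C := pairing (T x) y.

Lemma op_form_sesquilinear (T : {linear V -> antidual V}) :
  sesquilinear_form (op_form T).
Proof.
split=> k x y z; rewrite /op_form /pairing; first by rewrite linearP.
by rewrite antidual_linear.
Qed.

Lemma op_matrix_positiveP (A : V -> antidual V) (B : continuous_operator V)
    (T : V -> antidual V) :
  op_matrix_positive (op_matrix A (adjoint B) B T) <->
  forall x y, 0 <= op_form A x x +
    (op_form B x y + (op_form B x y)^*) + op_form T y y.
Proof.
have E x y : pairing2 (op_matrix A (adjoint B) B T (x, y)) (x, y) =
    op_form A x x + (op_form B x y + (op_form B x y)^*) + op_form T y y.
  rewrite /pairing2 /op_matrix /op_form /pairing/= [X in X + _]addrC.
  rewrite addrACA addrA [_ + A x x]addrC -!addrA; congr (_ + _).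
  by rewrite addrA [X in X + _]addrC -addrA.
by split=> [h x y|h [x y]]; [rewrite -E|rewrite E].
Qed.

Context (A B : continuous_operator V) (A_pos : op_positive A).
Context (V_barrelled : barrelled V).
Local Notation a := (op_form A).
Local Notation b := (op_form B).

Lemma dominated_of_bound y (M : C) : 0 <= M ->
  (forall x, `|b x y| ^+ 2 <= M * a x x) -> dominated a (b^~ y) (sqrtC M).
Proof.
move=> M0 h; split=> [|x]; first by rewrite sqrtC_ge0.
rewrite -sqrtCM ?qualifE//=; last exact: A_pos.
rewrite -[leLHS]sqrCK// ler_sqrtC ?qualifE/= ?exprn_ge0//.
by rewrite mulr_ge0//; exact: A_pos.
Qed.

(** Each [B x] is a continuous antilinear functional, so the set is an intersection of closed,
    convex, balanced sets. It is absorbing because every [b^~ y] is dominated. *)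
Lemma dominated_unit_barrel : (forall y, exists m, dominated a (b^~ y) m) ->
  barrel [set y : V | forall x, `|b x y| <= form_norm a x].
Proof.
move=> bd; have bS := op_form_sesquilinear B.
have A_ge0 : forall x, 0 <= a x x := A_pos.
have p0 := form_norm_ge0 A_ge0.
split.
- have -> : [set y : V | forall x, `|b x y| <= form_norm a x] =
      \bigcap_(x in setT) (B x @^-1` [set c | `|c| <= form_norm a x]).
    by apply/seteqP; split=> y h x; [move=> _|]; exact: h.
  apply: closed_bigI => x _; apply: preimage_closed => [|].
    by move=> y _; exact: antidual_continuous.
  move=> c cl; apply: (@ler_smallP _ _ _ 1) => // e e0 _.
  have [|c' [c'x cc']] := cl [set c' | `|c - c'| < e]; first by exists e.
  rewrite -[c](subrK c') mul1r addrC (le_trans (ler_normD _ _))// lerD//.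
  exact: ltW.
- apply/convex_setW => y z + + t t0 t1.
  have s0 : 0 <= 1 - t%:num by rewrite subr_ge0 ltW.
  rewrite !inE => yS zS x.
  have -> : b x (t%:num *: y + (1 - t%:num) *: z) =
      (t%:num)^* * b x y + (1 - t%:num)^* * b x z.
    by rewrite (sesq_linearr bS) (sesqZr bS).
  rewrite (le_trans (ler_normD _ _))// !normrM !norm_conjC.
  rewrite (ger0_norm s0) (gtr0_norm t0).
  have -> : form_norm a x = t%:num * form_norm a x + (1 - t%:num) * form_norm a x.
    by ring.
  by rewrite lerD// ler_wpM2l ?(ltW t0).
- move=> k y k1 yS x; rewrite (sesqZr bS) normrM norm_conjC.
  by rewrite (le_trans _ (yS x))// ler_piMl.
(* Passing to [m + 1] allows inversion when [m] is 0. *)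
- move=> y; have [m [m0 ym]] := bd y; have m1 : 0 < m + 1 by rewrite ltr_wpDl.
  exists (m + 1)^-1; first by rewrite invr_gt0.
  move=> k km x; rewrite (sesqZr bS) normrM norm_conjC.
  rewrite (le_trans (ler_wpM2l _ (ym x)))// mulrA -[leRHS]mul1r ler_wpM2r//.
  rewrite (le_trans (ler_wpM2r _ km))// ler_pdivrMl// mulr1 lerDl//.
Qed.

Lemma smallest_completion : (forall y, exists m, dominated a (b^~ y) m) ->
  exists T : {linear V -> antidual V},
    [/\ op_positive T, op_matrix_positive (op_matrix A (adjoint B) B T) &
      forall S : V -> antidual V,
        op_matrix_positive (op_matrix A (adjoint B) B S) -> op_le T S].
Proof.
move=> bd.
have aS := op_form_sesquilinear A; have bS := op_form_sesquilinear B.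
have [t tP] := representing_form aS A_pos bS bd.
have tS := representing_form_sesquilinear aS A_pos bS bd tP.
have S0 := V_barrelled (dominated_unit_barrel bd).
have t_antidual y : t y \in @antidual_pred C V.
  apply/asboolP; split=> [k u v|]; first by rewrite (sesq_linearr tS).
  have [m ym] := bd y.
  (* A single representative with error 1 suffices: each [z] in the barrel is dominated with
     constant 1, so [t y z] is within 1 of [b w z], itself at most [form_norm a w] in modulus. *)
  have [w yw] := represents_exists aS A_pos bS ym ltr01.
  apply: (antilinear_bounded_continuous _ S0 (_ : 0 <= 1 + form_norm a w)).
  - by move=> k u v; rewrite (sesq_linearr tS).
  - by rewrite addr_ge0// form_norm_ge0.
  move=> z /= zS; have z1 : dominated a (b^~ z) 1.
    by split=> // x; rewrite mul1r.
  have := tP _ _ _ _ _ yw z1; rewrite mul1r => h.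
  rewrite -[t y z](subrK (b w z)) (le_trans (ler_normD _ _))// lerD//.
  by rewrite distrC.
have T_linear : linear (fun y => AntiDual (t_antidual y)).
  by move=> k u v; apply/val_inj/funext => x /=; rewrite (sesq_linearl tS).
pose TL := GRing.isLinear.Build C V (antidual V) *:%R _ T_linear.
pose T : {linear V -> antidual V} := HB.pack (fun y => AntiDual (t_antidual y)) TL.
have Tpos := representing_form_ge0 aS A_pos bS bd tP.
exists T; split.
- move=> y; have := Tpos 0 y.
  by rewrite (sesq0l aS) (sesq0l bS) rmorph0 !add0r.
- exact/op_matrix_positiveP.
move=> S /op_matrix_positiveP hS y.
exact: (representing_form_min aS A_pos bS bd tP).
Qed.

End Operators.

(** * The equivalence and the smallest completion *)

Theorem theorem3p1 (R : realType) (H : completeNormedModType R[i])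
  (ip : {dot H for Num.conj}) (ip_norm : forall h : H, `|h| ^+ 2 = ip h h)
  (P : pred H) (D : subLmodType P) (D_dense : dense [set h : H | P h])
  (Alg : set {linear D -> D}) (Alg_dagger : dagger_algebra ip Alg)
  (Alg_barrelled : barrelled (graph_space Alg))
  (A B : continuous_operator (graph_space Alg)) (A_pos : op_positive A) :
  let assertion_i :=
    exists C : {linear graph_space Alg -> antidual (graph_space Alg)},
      op_positive C /\ op_matrix_positive (op_matrix A (adjoint B) B C) in
  let assertion_ii :=
    forall y : graph_space Alg, exists2 M : R[i], 0 <= M &
      forall x : graph_space Alg,
        `|pairing (B x) y| ^+ 2 <= M * pairing (A x) x in
  (assertion_i <-> assertion_ii) /\
  (assertion_i \/ assertion_ii ->
    exists A_B : {linear graph_space Alg -> antidual (graph_space Alg)},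
      [/\ op_positive A_B,
          op_matrix_positive (op_matrix A (adjoint B) B A_B) &
          forall C : {linear graph_space Alg -> antidual (graph_space Alg)},
            op_positive C ->
            op_matrix_positive (op_matrix A (adjoint B) B C) ->
            op_le A_B C]).
Proof.
move=> assertion_i assertion_ii.
have i_ii : assertion_i -> assertion_ii.
  move=> [C [C_pos /op_matrix_positiveP h]] y.
  (* Cauchy-Schwarz for the positive matrix: at [(k *: x, y)] it is a nonnegative quadratic in [k]
     with constant term [pairing (C y) y]. *)
  exists (pairing (C y) y); first exact: C_pos.
  move=> x; rewrite [leRHS]mulrC; apply: discriminant_le; [exact: A_pos|exact: C_pos|].
  move=> k; have := h (k *: x) y.
  have aS := op_form_sesquilinear A; have bS := op_form_sesquilinear B.
  by rewrite (sesqZl aS) (sesqZr aS) (sesqZl bS) mulrA -normCK.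
have ii_min : assertion_ii -> exists T : {linear graph_space Alg -> antidual (graph_space Alg)},
    [/\ op_positive T, op_matrix_positive (op_matrix A (adjoint B) B T) &
      forall S : graph_space Alg -> antidual (graph_space Alg),
        op_matrix_positive (op_matrix A (adjoint B) B S) -> op_le T S].
  move=> h; apply: smallest_completion => // y; have [M M0 yM] := h y.
  by exists (sqrtC M); exact: dominated_of_bound.
split; first split=> [//|/ii_min[T [T_pos T_mat _]]]; first by exists T.
move=> h; have /ii_min[T [T_pos T_mat T_min]] : assertion_ii by case: h => [/i_ii|].
by exists T; split=> // C _; exact: T_min.
Qed.
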